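(* Let $n\ge 3$, $K=\mathbb R^n_+$, let $A=(a_{ij})\in\mathbb R^{n\times n}$ be a symmetric matrix, $b=(b_1,\dots,b_n)^\top\in\mathbb R^n$, $c\in\mathbb R$, and let $f:\mathbb S^n\cap\operatorname{int}(K)\to\mathbb R$ be defined by $f(x)=\langle Ax,x\rangle+\langle b,x\rangle+c$. Consider the following statements: (i) The matrix $\operatorname{diag}^2(A)-A$ is copositive and $b_i\le 2[\lambda_{\min}(A)-a_{ii}]$ for all $i\in[n]$. (ii) The matrix $2[\lambda_{\min}(A)I-A]-\operatorname{diag}(b)$ is copositive and $b_i\le 0$ for all $i\in[n]$. (iii) The inequality $b_i\le 2[\lambda_{\min}(A)-a_{ii}]$ holds for all $i\in[n]$. (iv) The function $f$ is spherically convex. Then the following implications hold: (ii)$\implies$(iii), and (i)$\implies$(ii)$\implies$(iv).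
   Context: $\langle x,y\rangle=x^\top y$ is the canonical inner product on $\mathbb R^n$, $\|\cdot\|$ the Euclidean norm, $\mathbb S^n=\{x\in\mathbb R^n:\|x\|=1\}$, $[n]=\{1,\dots,n\}$, $\mathbb R^n_+$ is the nonnegative orthant, $I$ the identity matrix, and $\lambda_{\min}(A)$ the smallest eigenvalue of $A$. $\operatorname{diag}(b)$ is the diagonal matrix with diagonal entries $b_1,\dots,b_n$; $\operatorname{diag}^2(A)$ is the diagonal matrix having the same diagonal entries as $A$. A symmetric matrix $M$ is copositive if $\langle Mx,x\rangle\ge0$ for all $x\in\mathbb R^n_+$. Geodesics of $\mathbb S^n$ are great circles (intersections of $\mathbb S^n$ with two-dimensional subspaces); a minimal geodesic segment is a shortest great-circle arc joining two points, parametrized proportionally to arc length. A function $f:\mathbb S^n\cap\operatorname{int}(K)\to\mathbb R$ is spherically convex if for every minimal geodesic segment $\gamma:J\to\mathbb S^n\cap\operatorname{int}(K)$ ($J$ an interval), the composition $f\circ\gamma$ is convex on $J$. *)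

(* Defs.v *)
From HB Require Import structures.
From mathcomp Require Import all_boot all_order all_algebra.
From mathcomp Require Import all_classical all_reals all_analysis.

Set Implicit Arguments.
Unset Strict Implicit.
Unset Printing Implicit Defensive.

Import Order.TTheory GRing.Theory Num.Theory.
Import numFieldNormedType.Exports.

Local Open Scope classical_set_scope.
Local Open Scope ring_scope.

Definition dot (R : realType) n (x y : 'cV[R]_n) : R := (x^T *m y) 0 0.

(* MathComp-Analysis norms matrices by the maximum of the entries, hence a
   separate Euclidean norm; both induce the same topology. *)
Definition enorm (R : realType) n (x : 'cV[R]_n) : R := Num.sqrt (dot x x).

(* The unit sphere *of* R^n (so of dimension n - 1), denoted S^n here. *)
Definition sphere (R : realType) n : set 'cV[R]_n := [set x | enorm x = 1].

Definition nonneg_orthant (R : realType) n : set 'cV[R]_n :=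
  [set x | forall i, 0 <= x i 0].

(* The real spectrum is finite, and nonempty when A is symmetric (n > 0), so
   that the infimum is then attained.  [eigenvalue] refers to row
   eigenvectors, but A and A^T have the same eigenvalues. *)
Definition lambda_min (R : realType) n (A : 'M[R]_n) : R :=
  inf [set a | eigenvalue A a].

Definition diag2_mx (R : realType) n (A : 'M[R]_n) : 'M[R]_n :=
  diag_mx (\row_i A i i).

Definition copositive (R : realType) n (M : 'M[R]_n) : Prop :=
  M \is symmetricmx /\
  forall x : 'cV[R]_n, nonneg_orthant x -> 0 <= dot (M *m x) x.

Definition great_circle (R : realType) n (C : set 'cV[R]_n) : Prop :=
  exists2 V : {vspace 'cV[R]_n},
    \dim V = 2%N & C = @sphere R n `&` [set x | x \in V].

(* A C^1 curve on [a, b] running in a great circle with constant speed, i.e.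
   parametrized proportionally to arc length; it may wind around the circle.
   The values of gamma outside [a, b] are irrelevant. *)
Definition great_circle_arc (R : realType) n (a b : R)
    (gamma : R -> 'cV[R]_n) : Prop :=
  [/\ a <= b,
      exists2 C, great_circle C & forall t, t \in `[a, b] -> C (gamma t),
      {within `[a, b], continuous gamma},
      {in `]a, b[, forall t, derivable gamma t 1 /\
                             {for t, continuous gamma^`()%classic}} &
      exists k : R, {in `]a, b[, forall t, enorm (gamma^`()%classic t) = k}].

Definition arc_length (R : realType) n (a b : R)
    (gamma : R -> 'cV[R]_n) : \bar R :=
  (\int[lebesgue_measure]_(t in `]a, b[) (enorm (gamma^`()%classic t))%:E)%E.

Definition shortest_great_circle_arc (R : realType) n (a b : R)
    (gamma : R -> 'cV[R]_n) : Prop :=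
  great_circle_arc a b gamma /\
  forall (a' b' : R) (delta : R -> 'cV[R]_n),
    great_circle_arc a' b' delta ->
    delta a' = gamma a -> delta b' = gamma b ->
    (arc_length a b gamma <= arc_length a' b' delta)%E.

(* For J = [a, b] this says that gamma is a shortest arc on [a, b], since a
   subarc of a shortest arc is shortest; stating it on all compact subintervals
   also covers intervals J that do not contain their endpoints. *)
Definition minimal_geodesic_segment (R : realType) n (J : set R)
    (gamma : R -> 'cV[R]_n) : Prop :=
  is_interval J /\
  forall a b, J a -> J b -> a <= b -> shortest_great_circle_arc a b gamma.

(* f is only looked at on D. *)
Definition spherically_convex (R : realType) n (D : set 'cV[R]_n)
    (f : 'cV[R]_n -> R) : Prop :=
  forall (J : set R) (gamma : R -> 'cV[R]_n),
    minimal_geodesic_segment J gamma ->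
    (forall t, J t -> D (gamma t)) ->
    @convex_function R R^o J (f \o gamma).

(* Main.v *)
Require Import Defs.
From mathcomp Require Import all_boot all_order all_algebra.
From mathcomp Require Import all_classical all_reals all_analysis.
From mathcomp Require Import ring lra.

Import Order.TTheory GRing.Theory Num.Theory.
Import numFieldNormedType.Exports.

Local Open Scope classical_set_scope.
Local Open Scope ring_scope.

(** Along an arc gamma of a great circle, traversed at angular velocity w, the
    acceleration is - w^2 gamma, so that with gamma' = w z, |z| = 1,
      (f o gamma)'' = w^2 (2 (<Az, z> - <A gamma, gamma>) - <b, gamma>).
    On the nonnegative part of the sphere the parenthesis is nonnegative
    ([arc_acceleration_ge0]): <Az, z> is at least the smallest eigenvalue, and
    - b_i gamma_i is at least - b_i gamma_i^2 because 0 <= gamma_i <= 1 and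
    b_i <= 0, so the parenthesis is at least the value at gamma of the form of
    2 (lambda_min I - A) - diag b, which is copositive.

    Two facts support this computation.
    - An arc is only given as a C^1 curve of constant speed.  In an orthonormal
      basis of its plane it is a solution of x' = - w y, y' = w x
      ([great_circle_arc_rotation], from [rotation_of_unit_speed]), which makes
      it twice differentiable.
    - The infimum of the spectrum of a symmetric matrix is a lower bound of its
      Rayleigh quotient ([lambda_min_le_quad]).  No spectral theorem is used:
      at the infimum m of the quotient, A - m has a nonnegative form that is
      not coercive, hence is singular ([unitmx_psd_coercive]).

    The other implications compare quadratic forms.  The value of the form of
    2 (lambda_min I - A) - diag b at the i-th basis vector is
    2 (lambda_min - a_ii) - b_i, and the form itself is twice that of
    diag^2 A - A plus a diagonal form with these coefficients; the sign of b_i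
    comes from lambda_min <= a_ii. *)

(** * The inner product and quadratic forms *)

Section Dot.
Context {R : realType} {n : nat}.
Implicit Types (x y z : 'cV[R]_n) (M A : 'M[R]_n) (r : R).

Lemma dotE x y : dot x y = \sum_i x i 0 * y i 0.
Proof. by rewrite /dot mxE; apply: eq_bigr => i _; rewrite mxE. Qed.

Lemma dotC x y : dot x y = dot y x.
Proof. by rewrite !dotE; apply: eq_bigr => i _; rewrite mulrC. Qed.

Lemma dotDl x y z : dot (x + y) z = dot x z + dot y z.
Proof. by rewrite /dot linearD /= mulmxDl mxE. Qed.

Lemma dotDr x y z : dot z (x + y) = dot z x + dot z y.
Proof. by rewrite !(dotC z) dotDl. Qed.

Lemma dotZl r x y : dot (r *: x) y = r * dot x y.
Proof. by rewrite /dot linearZ /= -scalemxAl mxE. Qed.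

Lemma dotZr r x y : dot x (r *: y) = r * dot x y.
Proof. by rewrite !(dotC x) dotZl. Qed.

Lemma dot0l x : dot 0 x = 0.
Proof. by rewrite -(scale0r x) dotZl mul0r. Qed.

Lemma dot_mulmxl M x y : dot (M *m x) y = dot x (M^T *m y).
Proof. by rewrite /dot trmx_mul mulmxA. Qed.

Lemma dot_ge0 x : 0 <= dot x x.
Proof. by rewrite dotE; apply: sumr_ge0 => i _; rewrite -expr2 sqr_ge0. Qed.

Lemma dot_eq0 x : (dot x x == 0) = (x == 0).
Proof.
apply/idP/eqP => [|->]; last by rewrite dotE big1// => i _; rewrite mxE mul0r.
rewrite dotE psumr_eq0 => [/allP h|i _]; last by rewrite -expr2 sqr_ge0.
apply/colP => i; rewrite mxE; apply/eqP.
by have := h i (mem_index_enum i); rewrite mulf_eq0 orbb.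
Qed.

Lemma sqr_enorm x : enorm x ^+ 2 = dot x x.
Proof. by rewrite sqr_sqrtr// dot_ge0. Qed.

Lemma sphere_dot x : sphere x <-> dot x x = 1.
Proof.
split=> [xS|x1]; first by rewrite -sqr_enorm xS expr1n.
by rewrite /sphere/= /enorm x1 sqrtr1.
Qed.

Lemma sqr_coord_le_dot x i : x i 0 ^+ 2 <= dot x x.
Proof.
rewrite dotE (bigD1 i)//= -expr2 lerDl; apply: sumr_ge0 => j _.
by rewrite -expr2 sqr_ge0.
Qed.

Lemma symmetricmx_tr A : (A \is symmetricmx) = (A^T == A).
Proof. by rewrite is_hermitianmxE expr0 scale1r map_mx_id// eq_sym. Qed.

(** * The smallest eigenvalue bounds the Rayleigh quotient from below *)

Lemma quad_form_bounded M :
  exists2 C : R, 0 < C & forall x, dot (M *m x) x <= C * dot x x.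
Proof.
exists (1 + \sum_i \sum_j `|M i j|) => [|x].
  by rewrite ltr_pwDl// sumr_ge0// => i _; apply: sumr_ge0.
rewrite mulrDl mul1r -[leLHS]add0r; apply: lerD; first exact: dot_ge0.
have prod_le i j : `|x j 0 * x i 0| <= dot x x.
  have := sqr_coord_le_dot x i; have := sqr_coord_le_dot x j.
  by rewrite ler_norml; nra.
rewrite [leLHS]dotE mulr_suml; apply: ler_sum => i _.
rewrite mxE !mulr_suml; apply: ler_sum => j _.
rewrite -mulrA (le_trans (ler_norm _))// normrM.
by rewrite ler_wpM2l.
Qed.

(** Coercivity without diagonalisation.  Put y = B x.  Nonnegativity of the form
    at x - s y, with s small compared to the size of B, gives
    s |y|^2 <= <Bx, x>, and |x| is at most a constant times |y| because
    x = B^-1 y.  This is what turns an infimum of a quadratic form into an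
    eigenvalue. *)
Lemma unitmx_psd_coercive B : B^T = B -> B \in unitmx ->
  (forall x, 0 <= dot (B *m x) x) ->
  exists2 e : R, 0 < e & forall x, e * dot x x <= dot (B *m x) x.
Proof.
move=> BT Bu B0.
have [C C0 BC] := quad_form_bounded B.
have [C' C'0 BC'] := quad_form_bounded ((invmx B)^T *m invmx B).
have C0' := lt0r_neq0 C0; have C'0' := lt0r_neq0 C'0.
exists (C * C')^-1 => [|x]; first by rewrite invr_gt0 mulr_gt0.
set y := B *m x.
have xy : dot x x <= C' * dot y y.
  apply: le_trans (BC' y); rewrite -mulmxA dot_mulmxl trmxK.
  by rewrite /y mulKmx.
have yB : dot y y <= C * dot y x.
  rewrite -ler_pdivrMl//.
  (* This s minimises the bound -2 s |y|^2 + s^2 C |y|^2 on the change of the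
     form between x and x - s y. *)
  set s := C^-1.
  have := B0 (x - s *: y); rewrite mulmxBr -scalemxAr -/y.
  rewrite -scaleN1r -(scaleN1r (s *: y)) !(dotDl, dotDr, dotZl, dotZr).
  have -> : dot (B *m y) x = dot y y by rewrite dot_mulmxl BT.
  have : s * s * dot (B *m y) y <= s * dot y y.
    by rewrite -mulrA ler_pM2l ?invr_gt0// ler_pdivrMl.
  lra.
rewrite ler_pdivrMl ?mulr_gt0//.
apply: le_trans xy _; rewrite [C * C']mulrC -mulrA.
by rewrite ler_pM2l.
Qed.

(** Let m be the infimum of the Rayleigh quotient.  The form of A - m is
    nonnegative but not coercive, since otherwise m could be increased; hence
    A - m is singular, and m is an eigenvalue.  Evaluating the form at an
    eigenvector shows that m bounds the spectrum from below, so that the infimum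
    lambda_min A is a genuine one, at most m. *)
Lemma lambda_min_le_quad A x : A \is symmetricmx ->
  lambda_min A * dot x x <= dot (A *m x) x.
Proof.
rewrite symmetricmx_tr => /eqP AT.
have [->|x0] := eqVneq x 0.
  by rewrite mulmx0 dot0l mulr0.
pose S := [set r | exists2 z, dot z z != 0 & r = dot (A *m z) z / dot z z].
have [C _ AC] := quad_form_bounded (- A).
have S_inf : has_inf S.
  split; first by exists (dot (A *m x) x / dot x x); exists x => //; rewrite dot_eq0.
  exists (- C) => _ [z z0 ->].
  have zp : 0 < dot z z by rewrite lt_def z0 dot_ge0.
  rewrite ler_pdivlMr//; have := AC z.
  by rewrite mulNmx -scaleN1r dotZl; lra.
set m := inf S.
have mP z : m * dot z z <= dot (A *m z) z.
  have [->|z0] := eqVneq z 0.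
    by rewrite mulmx0 dot0l mulr0.
  rewrite -dot_eq0 in z0.
  have zp : 0 < dot z z by rewrite lt_def z0 dot_ge0.
  rewrite -ler_pdivlMr//; apply: ge_inf; first exact: S_inf.2.
  by exists z.
have quadB z : dot ((A - m%:M) *m z) z = dot (A *m z) z - m * dot z z.
  by rewrite mulmxBl mul_scalar_mx -scaleNr dotDl dotZl mulNr.
have m_eig : eigenvalue A m.
  rewrite /eigenvalue /eigenspace kermx_eq0 row_free_unit; apply/negP => Bu.
  have [||e e0 eP] := unitmx_psd_coercive _ _ Bu.
  - by rewrite linearB /= AT tr_scalar_mx.
  - by move=> z; rewrite quadB subr_ge0.
  have : m + e <= m.
    apply: lb_le_inf; first exact: S_inf.1.
    move=> _ [z z0 ->].
    have zp : 0 < dot z z by rewrite lt_def z0 dot_ge0.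
    by rewrite ler_pdivlMr// mulrDl addrC -lerBrDr -quadB.
  by rewrite gerDl leNgt e0.
have lb : lbound [set a | eigenvalue A a] m.
  move=> a /eigenvalueP[v vA v0].
  have w0 : v^T != 0 by rewrite trmx_eq0.
  rewrite -dot_eq0 in w0.
  have wp : 0 < dot v^T v^T by rewrite lt_def w0 dot_ge0.
  rewrite -(ler_pM2r wp); apply: le_trans (mP v^T) _.
  by rewrite -{1}AT -trmx_mul vA linearZ /= dotZl.
apply: le_trans (mP x); rewrite ler_pM2r ?lt_def ?dot_eq0 ?x0 ?dot_ge0//.
apply: ge_inf => //; by exists m.
Qed.

(** * The quadratic forms of the copositivity conditions *)

Lemma dot_delta x i : dot (delta_mx i 0) x = x i 0.
Proof.
rewrite dotE (bigD1 i)//= big1 ?addr0 => [|j ji]; rewrite !mxE ?eqxx ?mul1r//.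
by rewrite (negbTE ji) mul0r.
Qed.

Lemma quad_delta M i : dot (M *m delta_mx i 0) (delta_mx i 0) = M i i.
Proof. by rewrite dotC dot_delta -colE mxE. Qed.

Lemma lambda_min_le_diag A i : A \is symmetricmx -> lambda_min A <= A i i.
Proof.
move=> /(lambda_min_le_quad A (delta_mx i 0)).
by rewrite quad_delta dot_delta mxE !eqxx mulr1.
Qed.

Lemma diag_quad (d : 'rV[R]_n) x :
  dot (diag_mx d *m x) x = \sum_i d 0 i * x i 0 ^+ 2.
Proof.
by rewrite dotE; apply: eq_bigr => i _; rewrite mul_diag_mx mxE -mulrA expr2.
Qed.

Lemma quad_sub M N x :
  dot ((M - N) *m x) x = dot (M *m x) x - dot (N *m x) x.
Proof. by rewrite mulmxBl -scaleN1r dotDl dotZl mulN1r. Qed.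

Lemma shifted_quad A b x :
  dot ((2 *: ((lambda_min A)%:M - A) - diag_mx b^T) *m x) x =
  2 * (lambda_min A * dot x x - dot (A *m x) x) - \sum_i b i 0 * x i 0 ^+ 2.
Proof.
rewrite quad_sub -scalemxAl dotZl quad_sub mul_scalar_mx dotZl diag_quad.
by congr (_ - _); apply: eq_bigr => i _; rewrite mxE.
Qed.

(** The quantity is the second derivative of <Ax, x> + <b, x> along a great
    circle, at a point x passed with unit velocity t.  Bounding <At, t> below by the
    smallest eigenvalue leaves a quadratic form minus the linear form <b, x>.
    On the sphere 0 <= x_i <= 1, so that x_i^2 <= x_i, and b_i <= 0 makes
    - b_i x_i at least - b_i x_i^2: this is the quadratic form assumed
    copositive. *)
Lemma arc_acceleration_ge0 A b x t : A \is symmetricmx ->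
  copositive (2 *: ((lambda_min A)%:M - A) - diag_mx b^T) ->
  (forall i, b i 0 <= 0) -> nonneg_orthant x -> dot x x = 1 -> dot t t = 1 ->
  0 <= 2 * (dot (A *m t) t - dot (A *m x) x) - dot b x.
Proof.
move=> As [_ Mx] b0 x0 x1 t1.
have := Mx x x0; rewrite shifted_quad x1.
have := lambda_min_le_quad A t As; rewrite t1.
suff : dot b x <= \sum_i b i 0 * x i 0 ^+ 2 by lra.
rewrite dotE; apply: ler_sum => i _.
apply: ler_wnM2l; first exact: b0.
rewrite expr2 ler_piMr ?x0//.
have := sqr_coord_le_dot x i; rewrite x1.
by have := x0 i; nra.
Qed.

End Dot.

(** * Great-circle arcs as rotations of a plane *)

Section Rotations.
Context {R : realType} {n : nat}.

(** Gram-Schmidt applied to a basis of two vectors. *)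
Lemma vspace2_orthonormal_basis (V : {vspace 'cV[R]_n}) : \dim V = 2%N ->
  exists u v : 'cV[R]_n,
    [/\ dot u u = 1, dot v v = 1, dot u v = 0 &
        forall z, z \in V -> z = dot u z *: u + dot v z *: v].
Proof.
move=> dV.
have normalize (z : 'cV[R]_n) : z != 0 ->
    exists r v, z = r *: v /\ dot v v = 1.
  rewrite -dot_eq0 => z0; pose r := Num.sqrt (dot z z).
  have r0 : r != 0 by rewrite sqrtr_eq0 -ltNge lt_def z0 dot_ge0.
  exists r, (r^-1 *: z); rewrite scalerA divff// scale1r; split=> //.
  rewrite dotZl dotZr mulrA -expr2 exprVn sqr_sqrtr ?dot_ge0//.
  by rewrite mulVf.
move: (vbasisP V) (etrans (size_tuple (vbasis V)) dV).
case: (tval (vbasis V)) => [|e [|e' [|]]]// /andP[/eqP Vspan Vfree] _.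
move: Vfree; rewrite !free_cons span_seq1 span_nil memv0 => /and3P[ee' e'0 _].
have [r [v [e'E vv]]] := normalize e' e'0.
have e_neq : e - dot v e *: v != 0.
  apply: contra ee'; rewrite subr_eq0 => /eqP ->.
  apply/vlineP; exists (dot v e / r); rewrite e'E scalerA divfK//.
  by apply: contra e'0 => /eqP r0; rewrite e'E r0 scale0r.
have [q [u [eE uu]]] := normalize _ e_neq.
have uv : dot u v = 0.
  have q0 : q != 0 by apply: contra e_neq => /eqP q0; rewrite eE q0 scale0r.
  apply: (mulfI q0); rewrite -dotZl -eE -scaleN1r scalerA dotDl dotZl vv.
  by rewrite (dotC e) mulr1 mulN1r subrr mulr0.
exists u, v; split=> // z.
have {}eE : e = q *: u + dot v e *: v by rewrite -eE subrK.
rewrite -Vspan span_cons span_seq1.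
case/memv_addP => _ /vlineP[p ->] [_ /vlineP[p' ->] ->].
have -> : p *: e + p' *: e' = (p * q) *: u + (p * dot v e + p' * r) *: v.
  by rewrite {1}eE e'E scalerDr !scalerA -addrA -scalerDl.
by rewrite !dotDr !dotZr uu vv (dotC v u) uv !mulr1 !mulr0 addr0 add0r.
Qed.

(** A constant-speed curve on the unit circle rotates at a constant rate, so no
    angle function is needed.  The velocity is orthogonal to the position, hence
    equal to w (-y, x) with w = x y' - y x'.  The square of w is the squared
    speed k, and w is continuous; if it took both square roots of k it would
    vanish in between, forcing k = 0. *)
Lemma rotation_of_unit_speed (x y dx dy : R -> R) (a b k : R) :
  (forall t, t \in `]a, b[ -> is_derive t 1 x (dx t)) ->
  (forall t, t \in `]a, b[ -> is_derive t 1 y (dy t)) ->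
  (forall t, t \in `]a, b[ -> {for t, continuous dx}) ->
  (forall t, t \in `]a, b[ -> {for t, continuous dy}) ->
  (forall t, t \in `]a, b[ -> x t ^+ 2 + y t ^+ 2 = 1) ->
  (forall t, t \in `]a, b[ -> dx t ^+ 2 + dy t ^+ 2 = k) ->
  exists w, forall t, t \in `]a, b[ -> dx t = - (w * y t) /\ dy t = w * x t.
Proof.
move=> Dx Dy Cdx Cdy xy1 dk.
pose w t := x t * dy t - y t * dx t.
have tangent t : t \in `]a, b[ -> x t * dx t + y t * dy t = 0.
  move=> tab.
  have D1 : is_derive t 1 (x * x + y * y)
      (x t *: dx t + x t *: dx t + (y t *: dy t + y t *: dy t)).
    by have := Dx t tab; have := Dy t tab => ? ?; exact: is_deriveD.
  have D0 : is_derive t 1 (x * x + y * y) 0.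
    apply: near_eq_is_derive (is_derive_cst (1 : R) t 1).
    near=> s; rewrite /= -(xy1 s) ?fctE ?expr2//.
    by near: s; exact: near_in_itvoo.
  have := @derive_val _ _ _ _ _ _ _ D1; rewrite (@derive_val _ _ _ _ _ _ _ D0).
  by rewrite /GRing.scale/=; lra.
have dxE t : t \in `]a, b[ -> dx t = - (w t * y t).
  move=> tab; transitivity
    (dx t * (x t ^+ 2 + y t ^+ 2) - x t * (x t * dx t + y t * dy t)).
    by rewrite xy1// tangent// mulr1 mulr0 subr0.
  by rewrite /w; ring.
have dyE t : t \in `]a, b[ -> dy t = w t * x t.
  move=> tab; transitivity
    (dy t * (x t ^+ 2 + y t ^+ 2) - y t * (x t * dx t + y t * dy t)).
    by rewrite xy1// tangent// mulr1 mulr0 subr0.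
  by rewrite /w; ring.
have w2 t : t \in `]a, b[ -> w t ^+ 2 = k.
  move=> tab; rewrite -(dk t tab) (dxE t)// (dyE t)//.
  by rewrite sqrrN !exprMn -mulrDr addrC xy1// mulr1.
have Cw t : t \in `]a, b[ -> {for t, continuous w}.
  move=> tab; have cx : {for t, continuous x}.
    by apply/differentiable_continuous/derivable1_diffP; have := Dx t tab => -[].
  have cy : {for t, continuous y}.
    by apply/differentiable_continuous/derivable1_diffP; have := Dy t tab => -[].
  by apply: continuousB; apply: continuousM => //; [exact: Cdy|exact: Cdx].
have wle s t : s \in `]a, b[ -> t \in `]a, b[ -> s <= t -> w s = w t.
  move=> sab tab st.
  have [//|wst] := eqVneq (w s) (w t).
  have sub r : r \in `[s, t] -> r \in `]a, b[.
    move: sab tab; rewrite !in_itv/= => /andP[as_ _] /andP[_ tb] /andP[sr rt].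
    by rewrite (lt_le_trans as_)//= (le_lt_trans rt).
  have wN : w t = - w s.
    have := w2 t tab; rewrite -(w2 s sab) => /eqP; rewrite eqf_sqr eq_sym.
    by rewrite (negbTE wst)/= => /eqP.
  have [||r rst w0] := @IVT R w s t 0 st.
  - apply: continuous_in_subspaceT => r; rewrite inE/= => rst.
    exact/Cw/sub.
  - by rewrite wN; case: (leP (w s) (- w s)); rewrite /=; lra.
  - have k0 : k = 0 by rewrite -(w2 r (sub _ rst)) w0 expr0n.
    have z r' : r' \in `]a, b[ -> w r' = 0.
      by move=> rab; apply/eqP; rewrite -sqrf_eq0 w2// k0.
    by rewrite !z.
exists (w ((a + b) / 2)) => t tab.
have mab : (a + b) / 2 \in `]a, b[ by move: tab; rewrite !in_itv/=; lra.
have <- : w t = w ((a + b) / 2).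
  by have [tm|/ltW tm] := leP t ((a + b) / 2); [|apply/esym]; exact: wle.
by split; [exact: dxE|exact: dyE].
Unshelve. all: by end_near. Qed.

Lemma dot_continuous (u : 'cV[R]_n) : continuous (dot u).
Proof.
have -> : dot u = \sum_i (fun z : 'cV[R]_n => u i 0 * z i 0).
  by apply/funext => z; rewrite fct_sumE dotE.
elim/big_ind: _ => [|f g cf cg|i _] z.
- exact: (@cst_continuous _ _ (0 : R)).
- by apply: continuousD; [exact: cf|exact: cg].
- by apply: continuousM; [exact: cst_continuous|exact: coord_continuous].
Qed.

Lemma is_derive_dot (u : 'cV[R]_n) (gamma : R -> 'cV[R]_n) (t : R) :
  derivable gamma t 1 ->
  is_derive t 1 (fun s => dot u (gamma s)) (dot u (gamma^`()%classic t)).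
Proof.
move=> Dg; rewrite derive1E.
have dcvg : h^-1 *: (dot u (gamma (h *: 1 + t)) - dot u (gamma t))
    @[h --> 0^'] --> dot u ('D_1 gamma t).
  have -> : (fun h : R => h^-1 *: (dot u (gamma (h *: 1 + t)) - dot u (gamma t)))
     = dot u \o (fun h : R => h^-1 *: ((gamma \o shift t) (h *: 1) - gamma t)).
    apply/funext => h; apply: esym.
    rewrite -(mulN1r (dot u (gamma t))) -dotZr scaleN1r -dotDr.
    exact: dotZr.
  apply: continuous_cvg; last exact: Dg.
  exact: dot_continuous.
by split; [apply/cvg_ex; exists (dot u ('D_1 gamma t))|exact: cvg_lim dcvg].
Qed.

(** The coordinates of the arc in an orthonormal basis of its plane run on the
    unit circle at constant speed, and so satisfy the equations of a rotation.
    The velocity of the arc is not known beforehand to lie in the plane: that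
    its coordinates carry the whole speed comes from computing the derivative of
    <g', gamma>, for a fixed vector g' equal to the velocity at t, in two ways. *)
Lemma great_circle_arc_rotation (a b : R) (gamma : R -> 'cV[R]_n) :
  great_circle_arc a b gamma ->
  exists (u v : 'cV[R]_n) (x y : R -> R) (w : R),
  [/\ [/\ dot u u = 1, dot v v = 1 & dot u v = 0],
      forall t, t \in `[a, b] ->
        gamma t = x t *: u + y t *: v /\ x t ^+ 2 + y t ^+ 2 = 1,
      {within `[a, b], continuous x} /\ {within `[a, b], continuous y} &
      forall t, t \in `]a, b[ ->
        is_derive t 1 x (- (w * y t)) /\ is_derive t 1 y (w * x t)].
Proof.
move=> [_ [C [V dV ->] gV] gC gD [k gk]].
have [u [v [uu vv uv uvV]]] := vspace2_orthonormal_basis V dV.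
pose x t := dot u (gamma t); pose y t := dot v (gamma t).
pose dx t := dot u (gamma^`()%classic t).
pose dy t := dot v (gamma^`()%classic t).
have gE t : t \in `[a, b] -> gamma t = x t *: u + y t *: v.
  by move=> /gV[_ /uvV].
have xy1 t : t \in `[a, b] -> x t ^+ 2 + y t ^+ 2 = 1.
  move=> tab; have /sphere_dot := (gV t tab).1; rewrite gE//.
  rewrite !(dotDl, dotDr, dotZl, dotZr) uu vv (dotC v) uv !mulr0 addr0 add0r.
  by rewrite !mulr1 !expr2.
have oc t : t \in `]a, b[ -> t \in `[a, b].
  exact: subset_itv_oo_cc.
have Dx t : t \in `]a, b[ -> is_derive t 1 x (dx t).
  by move=> /gD[? _]; exact: is_derive_dot.
have Dy t : t \in `]a, b[ -> is_derive t 1 y (dy t).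
  by move=> /gD[? _]; exact: is_derive_dot.
have dk t : t \in `]a, b[ -> dx t ^+ 2 + dy t ^+ 2 = k ^+ 2.
  move=> tab; rewrite -(gk t tab) sqr_enorm; have [Dg _] := gD t tab.
  set g' := gamma^`()%classic t.
  have D1 : is_derive t 1 (dot g' u \*: x + dot g' v \*: y)
      (dot g' u *: dx t + dot g' v *: dy t).
    by have := Dx t tab; have := Dy t tab => ? ?; exact: is_deriveD.
  have D2 : is_derive t 1 (dot g' u \*: x + dot g' v \*: y) (dot g' g').
    apply: near_eq_is_derive (is_derive_dot g' _ _ Dg).
    near=> s; rewrite gE ?dotDr ?dotZr; last first.
      by apply: oc; near: s; exact: near_in_itvoo.
    by rewrite (mulrC (x s)) (mulrC (y s)).
  have := @derive_val _ _ _ _ _ _ _ D1; rewrite (@derive_val _ _ _ _ _ _ _ D2).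
  by move=> ->; rewrite /GRing.scale/= !(dotC g') !expr2.
have [w wP] := rotation_of_unit_speed x y dx dy a b (k ^+ 2) Dx Dy
  (fun t tab => continuous_comp (gD t tab).2 (@dot_continuous u _))
  (fun t tab => continuous_comp (gD t tab).2 (@dot_continuous v _))
  (fun t tab => xy1 t (oc t tab)) dk.
exists u, v, x, y, w; split=> //.
- by move=> t tab; split; [exact: gE|exact: xy1].
- by split=> t; apply: continuous_comp (gC t) _; exact: dot_continuous.
- by move=> t tab; have [<- <-] := wP t tab; split; [exact: Dx|exact: Dy].
Unshelve. all: by end_near. Qed.

(** A polynomial of degree 2 along x' = - w y, y' = w x has as second derivative
    w^2 times the expression assumed nonnegative.  That expression is
    twice the difference of the values of the quadratic part at (- y, x) and at
    (x, y), minus the linear part at (x, y). *)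
Lemma convex_on_rotation (x y : R -> R) (w a b p q r l m : R)
    (g := p \*: (x * x) + q \*: (x * y) + r \*: (y * y) + l \*: x + m \*: y) :
  a <= b ->
  {within `[a, b], continuous x} -> {within `[a, b], continuous y} ->
  (forall t, t \in `]a, b[ ->
    is_derive t 1 x (- (w * y t)) /\ is_derive t 1 y (w * x t)) ->
  (forall t, t \in `]a, b[ ->
    0 <= 2 * (p - r) * (y t ^+ 2 - x t ^+ 2) - 4 * q * (x t * y t)
         - l * x t - m * y t) ->
  forall s : {i01 R}, g (conv s (a : R^o) b) <= conv s (g a : R^o) (g b).
Proof.
rewrite le_eqVlt => /predU1P[<- _ _ _ _ s|ab Cx Cy D pos s].
  by rewrite !convmm.
have [_ xa xb] := (continuous_within_itvP _ ab).1 Cx.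
have [_ ya yb] := (continuous_within_itvP _ ab).1 Cy.
pose g1 := w \*: ((2 * (r - p)) \*: (x * y) + q \*: (x * x) - q \*: (y * y)
  - l \*: y + m \*: x).
have g1E t : g1 t = w * (2 * (r - p) * (x t * y t) + q * (x t * x t)
  - q * (y t * y t) - l * y t + m * x t) by [].
have Dg t : t \in `]a, b[ -> is_derive t 1 g (g1 t).
  move=> /D[? ?]; apply: is_derive_eq; rewrite g1E /GRing.scale/=.
  ring.
have DDg t : t \in `]a, b[ -> is_derive t 1 ('D_1 g)
   (w ^+ 2 * (2 * (p - r) * (y t ^+ 2 - x t ^+ 2) - 4 * q * (x t * y t)
         - l * x t - m * y t)).
  move=> tab; apply: (@near_eq_is_derive _ _ _ g1).
    near=> z; have zab : z \in `]a, b[ by near: z; exact: near_in_itvoo.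
    by rewrite (@derive_val _ _ _ _ _ _ _ (Dg z zab)).
  have [? ?] := D t tab; apply: is_derive_eq; rewrite /GRing.scale/=.
  ring.
apply: second_derivative_convex (ltW ab).
- move=> t tab; have tab' : t \in `]a, b[ by rewrite in_itv.
  rewrite (@derive_val _ _ _ _ _ _ _ (DDg t tab')).
  by rewrite mulr_ge0 ?sqr_ge0 ?pos.
- by do 4?apply: cvgD; apply: cvgZl_tmp => //; exact: cvgM.
- by do 4?apply: cvgD; apply: cvgZl_tmp => //; exact: cvgM.
- by move=> t /Dg[].
- by move=> t /DDg[].
Unshelve. all: by end_near. Qed.

End Rotations.

(** * Convexity along great-circle arcs *)

(** The hypothesis has no reference to the plane of the arc, which is why z
    ranges over all unit vectors; it is used at the direction of motion.  In
    coordinates, f o gamma is a polynomial of degree 2 on a rotation. *)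
Lemma quad_circle_arc_convex {R : realType} {n : nat} (A : 'M[R]_n)
    (e : 'cV[R]_n) (c a b : R) (gamma : R -> 'cV[R]_n)
    (f := fun x => dot (A *m x) x + dot e x + c) :
  A \is symmetricmx -> great_circle_arc a b gamma ->
  (forall t z, t \in `[a, b] -> dot z z = 1 ->
    0 <= 2 * (dot (A *m z) z - dot (A *m gamma t) (gamma t)) - dot e (gamma t)) ->
  forall s : {i01 R},
  f (gamma (conv s (a : R^o) b)) <= conv s (f (gamma a) : R^o) (f (gamma b)).
Proof.
rewrite symmetricmx_tr => /eqP AT arc pos s; have ab : a <= b by case: arc.
have [u [v [x [y [w [[uu vv uv] gE [Cx Cy] D]]]]]] :=
  great_circle_arc_rotation a b gamma arc.
have quadE p q : dot (A *m (p *: u + q *: v)) (p *: u + q *: v) =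
    dot (A *m u) u * p ^+ 2 + 2 * dot (A *m u) v * (p * q)
    + dot (A *m v) v * q ^+ 2.
  rewrite mulmxDr -!scalemxAr !(dotDl, dotDr, dotZl, dotZr).
  have -> : dot (A *m v) u = dot (A *m u) v by rewrite dot_mulmxl AT dotC.
  ring.
have linE p q : dot e (p *: u + q *: v) = dot e u * p + dot e v * q.
  by rewrite dotDr !dotZr !(mulrC _ (dot e _)).
have oc t : t \in `]a, b[ -> t \in `[a, b].
  exact: subset_itv_oo_cc.
have sab : conv s (a : R^o) b \in `[a, b] by exact: convR_itv.
have := convex_on_rotation x y w a b (dot (A *m u) u) (2 * dot (A *m u) v)
  (dot (A *m v) v) (dot e u) (dot e v) ab Cx Cy D.
set g := (X in forall s : {i01 R}, X _ <= _).
have fE t : t \in `[a, b] -> f (gamma t) = g t + c.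
  move=> tab; rewrite /f (gE t tab).1 quadE linE.
  rewrite (_ : g t = dot (A *m u) u * (x t * x t) +
    2 * dot (A *m u) v * (x t * y t) + dot (A *m v) v * (y t * y t) +
    dot e u * x t + dot e v * y t)//.
  ring.
move=> /(_ _ s) gconv.
rewrite !fE// ?in_itv/= ?lexx ?ab//.
have -> : conv s (g a + c : R^o) (g b + c) = conv s (g a : R^o) (g b) + c.
  by rewrite !convRE !mulrDr addrACA -mulrDl [X in X * c]subrKC mul1r.
rewrite lerD2r; apply: gconv => t tab.
have tcc := oc t tab; have [gt xy1] := gE t tcc.
(* The velocity of the arc is w times this vector. *)
have tau1 : dot (- y t *: u + x t *: v) (- y t *: u + x t *: v) = 1.
  rewrite !(dotDl, dotDr, dotZl, dotZr) uu vv (dotC v) uv -[RHS]xy1; ring.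
have := pos t _ tcc tau1; rewrite gt !quadE linE.
by congr (_ <= _); ring.
Qed.

Theorem theorem4 (R : realType) (n : nat) (hn : (3 <= n)%N)
    (A : 'M[R]_n) (hA : A \is symmetricmx) (b : 'cV[R]_n) (c : R) :
  let K : set 'cV[R]_n := @nonneg_orthant R n in
  let f := fun x : 'cV[R]_n => dot (A *m x) x + dot b x + c in
  let st_i := copositive (diag2_mx A - A) /\
    (forall i, b i 0 <= 2 * (lambda_min A - A i i)) in
  let st_ii := copositive (2 *: ((lambda_min A)%:M - A) - diag_mx b^T) /\
    (forall i, b i 0 <= 0) in
  let st_iii := forall i, b i 0 <= 2 * (lambda_min A - A i i) in
  let st_iv := spherically_convex (@sphere R n `&` K°) f in
  [/\ st_ii -> st_iii, st_i -> st_ii & st_ii -> st_iv].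
Proof.
move=> K f st_i st_ii st_iii st_iv; split.
- move=> [[_ Mpos] _] i.
  have := Mpos (delta_mx i 0); rewrite quad_delta !mxE !eqxx !mulr1n => h.
  by rewrite -subr_ge0; apply: h => j; rewrite mxE ler0n.
- move=> [[_ Apos] bA]; split; last first.
    move=> i; apply: le_trans (bA i) _.
    by rewrite pmulr_rle0// subr_le0 lambda_min_le_diag.
  split.
    have /eqP AT : A^T == A by rewrite -symmetricmx_tr.
    by rewrite symmetricmx_tr linearB linearZ /= linearB /= tr_scalar_mx AT
      tr_diag_mx.
  move=> x x0; rewrite shifted_quad.
  have := Apos x x0; rewrite quad_sub diag_quad.
  suff : \sum_i b i 0 * x i 0 ^+ 2 <= 2 * (lambda_min A * dot x x -
     \sum_i (\row_j A j j) 0 i * x i 0 ^+ 2) by lra.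
  rewrite dotE mulr_sumr -sumrB mulr_sumr; apply: ler_sum => i _.
  rewrite mxE -expr2 -mulrBl [leRHS]mulrA.
  by rewrite ler_wpM2r ?sqr_ge0.
- move=> [Mcop b0] J gamma [Jitv Jarc] gD s x y.
  wlog xy : s x y / x <= y => [W xJ yJ|].
    have [xy|/ltW yx] := leP x y; first exact: W.
    by rewrite convC [leRHS]convC; exact: W.
  rewrite !inE => xJ yJ.
  apply: quad_circle_arc_convex => //; first exact: (Jarc x y xJ yJ xy).1.
  move=> t z; rewrite in_itv/= => txy zz.
  have [/sphere_dot g1 /interior_subset g0] := gD t (Jitv x y xJ yJ t txy).
  exact: arc_acceleration_ge0.
Qed.
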